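(* Let $V$ be a vertex algebra over $\mathbb{C}$ with a good filtration $E=\{E_n\}_{n\in\mathbb{Z}}$, and let $$\mathrm{gr}_E V=\coprod_{n\in\mathbb{Z}}(\mathrm{gr}_E V)_n,\qquad (\mathrm{gr}_EV)_n=E_n/E_{n-1}.$$ For $m,n\in\mathbb{Z}$, $u\in E_m$, $v\in E_n$ define $$(u+E_{m-1})\cdot(v+E_{n-1})=u_{-1}v+E_{m+n-1}\in E_{m+n}/E_{m+n-1},$$ $$\partial(u+E_{m-1})=\mathcal{D}u+E_{m-1}\in E_m/E_{m-1},$$ $$Y_-(u+E_{m-1},x)(v+E_{n-1})=\sum_{i\ge 0}(u_iv+E_{m+n-2})x^{-i-1}\in x^{-1}(E_{m+n-1}/E_{m+n-2})[x^{-1}],$$ extended (bi)linearly to $\mathrm{gr}_E V$ (these are well defined). Then $\mathrm{gr}_E V$ equipped with $(\cdot,\partial,Y_-)$ is a vertex Poisson algebra. Furthermore, for $m,n\in\mathbb{Z}$, $a\in E_m/E_{m-1}$, $b\in E_n/E_{n-1}$ and $i\ge 0$, $$\partial(\mathrm{gr}_EV)_m\subset(\mathrm{gr}_EV)_m,\qquad ab\in(\mathrm{gr}_EV)_{m+n},\qquad a_ib\in(\mathrm{gr}_EV)_{m+n-1},$$ where $Y_-(a,x)b=\sum_{i\ge0}a_ib\,x^{-i-1}$.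
   Context: Vertex algebra: a vector space $V$ over $\mathbb{C}$ with a linear map $Y:V\to\mathrm{Hom}(V,V((x)))$, $v\mapsto Y(v,x)=\sum_{n\in\mathbb{Z}}v_nx^{-n-1}$ ($v_n\in\mathrm{End}\,V$), and a vector $\mathbf{1}\in V$ such that $Y(\mathbf{1},x)=\mathrm{id}$; $Y(v,x)\mathbf{1}\in V[[x]]$ with $v_{-1}\mathbf{1}=v$ for $v\in V$; and for $u,v\in V$ the Jacobi identity holds: $$x_0^{-1}\delta\left(\tfrac{x_1-x_2}{x_0}\right)Y(u,x_1)Y(v,x_2)-x_0^{-1}\delta\left(\tfrac{x_2-x_1}{-x_0}\right)Y(v,x_2)Y(u,x_1)=x_2^{-1}\delta\left(\tfrac{x_1-x_0}{x_2}\right)Y(Y(u,x_0)v,x_2),$$ where $\delta(x)=\sum_{n\in\mathbb{Z}}x^n$ and powers of binomials are expanded in nonnegative powers of the second variable. Put $\mathcal{D}v=v_{-2}\mathbf{1}$. Good filtration of $V$: an increasing family of subspaces $\cdots\subset E_{-1}\subset E_0\subset E_1\subset\cdots$ ($n\in\mathbb{Z}$) with $\bigcup_{n\in\mathbb{Z}}E_n=V$, $\mathbf{1}\in E_0$, and for $u\in E_m$, $v\in E_n$: $u_jv\in E_{m+n}$ for $j<0$ and $u_jv\in E_{m+n-1}$ for $j\ge0$. It follows that $\mathcal{D}E_m\subset E_m$. Vertex Lie algebra: a vector space $A$ with a linear operator $\partial$ and bilinear products $(a,b)\mapsto a_nb$ ($n\in\mathbb{N}=\{0,1,2,\dots\}$)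 such that for $a,b,c\in A$, $m,n\in\mathbb{N}$: (C0) $a_nb=0$ for $n$ sufficiently large; (C1) $(\partial a)_nb=-n\,a_{n-1}b$ (which is $0$ for $n=0$); (C2) $a_nb=\sum_{i\ge0}(-1)^{n+i+1}\frac{1}{i!}\partial^i(b_{n+i}a)$; (C3) $a_mb_nc-b_na_mc=\sum_{i=0}^m\binom{m}{i}(a_ib)_{m+n-i}c$. One writes $Y_-(a,x)b=\sum_{n\ge0}a_nb\,x^{-n-1}$. Differential algebra: a commutative associative $\mathbb{C}$-algebra with identity, equipped with a derivation $\partial$. Vertex Poisson algebra: a differential algebra $(A,\partial)$ with a vertex Lie algebra structure $(Y_-,\partial)$ (same $\partial$) such that $a_n(bc)=(a_nb)c+b(a_nc)$ for all $a,b,c\in A$, $n\ge0$. *)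

(* Defs.v *)
From HB Require Import structures.
From mathcomp Require Import all_boot all_order all_algebra.
From mathcomp Require Import complex.
From mathcomp Require Import boolp classical_sets functions cardinality fsbigop.
From mathcomp Require Import reals.

Set Implicit Arguments.
Unset Strict Implicit.
Unset Printing Implicit Defensive.

Import Order.TTheory GRing.Theory Num.Theory.

Local Open Scope quotient_scope.
Local Open Scope classical_set_scope.
Local Open Scope ring_scope.

Section FormalSeries.
Variable K : numFieldType.

(* A formal series in x0^(+-1), x1^(+-1), x2^(+-1) with coefficients in W is
   the function sending the exponent triple (r, p, q) to the coefficient of
   x0^r x1^p x2^q. *)
Definition series3 (W : Type) := int * int * int -> W.

(* Cauchy product.  The sum is finite in the products occurring in the Jacobi
   identity below; a sum with infinite support would be 0. *)
Definition mul_series3 (W : lmodType K) (f : series3 K) (g : series3 W) :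
    series3 W :=
  fun e => \sum_(a \in [set: int * int * int]) f a *: g (e - a).

Definition binomZ (n : int) (k : nat) : K :=
  (\prod_(j < k) (n%:~R - j%:R)) / k`!%:R.

(* Coefficient of y^p z^q in (y - z)^n, expanded in nonnegative powers of z. *)
Definition powB_coef (n p q : int) : K :=
  if q is Posz k then
    if p == n - q then (-1) ^+ k * binomZ n k else 0
  else 0.

(* x0^-1 delta((x1 - x2) / x0) = sum_n x0^(-n-1) (x1 - x2)^n *)
Definition delta_x1_x2 : series3 K :=
  fun '(r, p, q) => powB_coef (- r - 1) p q.

(* x0^-1 delta((x2 - x1) / (- x0)) = sum_n (-1)^n x0^(-n-1) (x2 - x1)^n *)
Definition delta_x2_x1 : series3 K :=
  fun '(r, p, q) => (-1) ^ (- r - 1) * powB_coef (- r - 1) q p.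

(* x2^-1 delta((x1 - x0) / x2) = sum_n x2^(-n-1) (x1 - x0)^n *)
Definition delta_x1_x0 : series3 K :=
  fun '(r, p, q) => powB_coef (- q - 1) p r.

End FormalSeries.

Arguments delta_x1_x2 {K}.
Arguments delta_x2_x1 {K}.
Arguments delta_x1_x0 {K}.

(* [va_mode u n v] is u_n v, the coefficient of x^(-n-1) in Y(u, x) v.  The
   Jacobi identity between operator-valued series is stated after application
   to an arbitrary vector w, coefficient by coefficient. *)
Record vertex_algebra (K : numFieldType) (V : lmodType K) := VertexAlgebra {
  va_mode :> V -> int -> V -> V;
  va_one : V;
  va_linearl : forall n v, linear (fun u => va_mode u n v);
  va_linearr : forall u n, linear (va_mode u n);
  va_trunc : forall u v, exists N : int, forall n, N <= n -> va_mode u n v = 0;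
  va_vacuum : forall n v, va_mode va_one n v = if n == -1 then v else 0;
  va_creation0 : forall v n, 0 <= n -> va_mode v n va_one = 0;
  va_creation : forall v, va_mode v (-1) va_one = v;
  va_Jacobi : forall (u v w : V) (e : int * int * int),
    mul_series3 delta_x1_x2
      (fun '(r, p, q) => (* Y(u, x1) Y(v, x2) w *)
         if r == 0 then va_mode u (- p - 1) (va_mode v (- q - 1) w) else 0) e
    - mul_series3 delta_x2_x1
      (fun '(r, p, q) => (* Y(v, x2) Y(u, x1) w *)
         if r == 0 then va_mode v (- q - 1) (va_mode u (- p - 1) w) else 0) e
    = mul_series3 delta_x1_x0
      (fun '(r, p, q) => (* Y(Y(u, x0) v, x2) w *)
         if p == 0 then va_mode (va_mode u (- r - 1) v) (- q - 1) w else 0) e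
}.

Definition va_D (K : numFieldType) (V : lmodType K) (Y : vertex_algebra V)
  (v : V) : V := Y v (-2) (va_one Y).

Record is_good_filtration (K : numFieldType) (V : lmodType K)
    (Y : vertex_algebra V) (E : int -> submodClosed V) : Prop := {
  gf_incr : forall m n, m <= n -> {subset E m <= E n};
  gf_cover : forall v : V, exists n, v \in E n;
  gf_one : va_one Y \in E 0;
  gf_neg : forall m n u v j, u \in E m -> v \in E n -> j < 0 ->
    Y u j v \in E (m + n);
  gf_nneg : forall m n u v j, u \in E m -> v \in E n -> 0 <= j ->
    Y u j v \in E (m + n - 1)
}.

Section VertexPoisson.
Variables (K : numFieldType) (A : lmodType K).
Implicit Types (d : A -> A) (prod : A -> nat -> A -> A) (mul : A -> A -> A).

(* [prod a n b] is a_n b.  By C0 the sum in C2 is finite. *)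
Record is_vertex_Lie_algebra d prod : Prop := {
  vL_linear : linear d;
  vL_linearl : forall n b, linear (fun a => prod a n b);
  vL_linearr : forall a n, linear (prod a n);
  vL_C0 : forall a b, exists N : nat, forall n, (N <= n)%N -> prod a n b = 0;
  vL_C1 : forall a b n, prod (d a) n b = - (prod a n.-1 b *+ n);
  vL_C2 : forall a b n, prod a n b =
    \sum_(i \in [set: nat])
       ((-1) ^+ (n + i + 1)%N / i`!%:R) *: iter i d (prod b (n + i)%N a);
  vL_C3 : forall a b c m n,
    prod a m (prod b n c) - prod b n (prod a m c) =
    \sum_(i < m.+1) prod (prod a i b) (m + n - i)%N c *+ 'C(m, i)
}.

(* Not the library's commutative algebras, which exclude the zero algebra:
   here 1 = 0 is allowed. *)
Record is_differential_algebra mul (one : A) d : Prop := {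
  dA_mulC : commutative mul;
  dA_mulA : associative mul;
  dA_mul1 : left_id one mul;
  dA_linearl : forall b, linear (fun a => mul a b);
  dA_linearr : forall a, linear (mul a);
  dA_linear : linear d;
  dA_Leibniz : forall a b, d (mul a b) = mul (d a) b + mul a (d b)
}.

Record is_vertex_Poisson_algebra mul (one : A) d prod : Prop := {
  vP_differential : is_differential_algebra mul one d;
  vP_Lie : is_vertex_Lie_algebra d prod;
  vP_Leibniz : forall a n b c,
    prod a n (mul b c) = mul (prod a n b) c + mul b (prod a n c)
}.

End VertexPoisson.

Section Subspace.
Variables (K : numFieldType) (V : lmodType K) (S : submodClosed V).

Record subsp := Subsp { subsp_val : V; _ : subsp_val \in S }.

HB.instance Definition _ := [isSub for subsp_val].
HB.instance Definition _ := [Choice of subsp by <:].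
HB.instance Definition _ := [SubChoice_isSubLmodule of subsp by <:].

End Subspace.

Section QuotientSpace.
Variables (K : numFieldType) (V : lmodType K) (S T : submodClosed V).

Definition relative : {pred subsp S} := fun x => val x \in T.

Lemma relativeE x : (x \in relative) = (val x \in T).
Proof. by []. Qed.

Fact relative_closed : subsemimod_closed relative.
Proof.
split=> [|a x]; last by rewrite !relativeE linearZ; exact: rpredZ.
split=> [|x y]; first by rewrite relativeE raddf0 rpred0.
by rewrite !relativeE raddfD; exact: rpredD.
Qed.

HB.instance Definition _ :=
  GRing.isSubmodClosed.Build K (subsp S) relative relative_closed.

(* S / (S :&: T), that is S / T when T is included in S *)
Definition quotspace : Type := Quotient.quot relative.

HB.instance Definition _ := GRing.Zmodule.on quotspace.
HB.instance Definition _ := EqQuotient.on quotspace.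

Definition quotspace_scale (a : K) (x : quotspace) : quotspace :=
  \pi_quotspace (a *: repr x).

Lemma quotspace_eq (x y : subsp S) :
  (\pi_quotspace x = \pi_quotspace y) <-> (val x - val y \in T).
Proof.
split=> [/eqP|h].
  by rewrite -Quotient.idealrBE relativeE raddfB.
by apply/eqP; rewrite -Quotient.idealrBE relativeE raddfB.
Qed.

Lemma quotspace_scaleE a x :
  quotspace_scale a (\pi_quotspace x) = \pi_quotspace (a *: x).
Proof.
apply/quotspace_eq.
have -> : val (a *: repr (\pi_quotspace x)) - val (a *: x) =
          a *: (val (repr (\pi_quotspace x)) - val x).
  by rewrite scalerBr; congr (_ - _); exact: linearZ.
by apply: rpredZ; apply/quotspace_eq; rewrite reprK.
Qed.

Fact quotspace_addE (x y : subsp S) :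
  \pi_quotspace (x + y) = \pi_quotspace x + \pi_quotspace y.
Proof. exact: (raddfD (\pi_(Quotient.quot relative))). Qed.

Fact quotspace_scaleA a b x :
  quotspace_scale a (quotspace_scale b x) = quotspace_scale (a * b) x.
Proof.
by elim/quotW: x => x; rewrite (quotspace_scaleE b) !quotspace_scaleE scalerA.
Qed.

Fact quotspace_scale1 : left_id 1 quotspace_scale.
Proof. by elim/quotW => x; rewrite quotspace_scaleE scale1r. Qed.

Fact quotspace_scaleDr : right_distributive quotspace_scale +%R.
Proof.
move=> a; elim/quotW => x; elim/quotW => y; rewrite -quotspace_addE.
by rewrite !quotspace_scaleE scalerDr quotspace_addE.
Qed.

Fact quotspace_scaleDl x : {morph quotspace_scale^~ x : a b / a + b}.
Proof.
by elim/quotW: x => x a b; rewrite !quotspace_scaleE scalerDl quotspace_addE.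
Qed.

HB.instance Definition _ := GRing.Zmodule_isLmodule.Build K quotspace
  quotspace_scaleA quotspace_scale1 quotspace_scaleDr quotspace_scaleDl.

End QuotientSpace.

Section Coproduct.
Variables (K : numFieldType) (I : choiceType) (W : I -> lmodType K).

Record coprod := Coprod {
  coprod_fun :> forall i, W i;
  coprod_finite : finite_set [set i | coprod_fun i != 0]
}.

Lemma coprodP (f g : coprod) : (forall i, f i = g i) -> f = g.
Proof.
case: f g => [f ff] [g gf] /= fg.
have {}fg : f = g by exact: functional_extensionality_dep.
by case: _ / fg in gf *; congr Coprod; exact: Prop_irrelevance.
Qed.

HB.instance Definition _ := gen_eqMixin coprod.
HB.instance Definition _ := gen_choiceMixin coprod.

Fact coprod_zero_finite : finite_set [set i | (0 : W i) != 0].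
Proof. by rewrite (_ : mkset _ = set0) // -subset0 => i /=; rewrite eqxx. Qed.

Fact coprod_add_finite (f g : coprod) :
  finite_set [set i | f i + g i != 0].
Proof.
apply: (@sub_finite_set _ _ ([set i | f i != 0] `|` [set i | g i != 0])).
  move=> i /=; case: (eqVneq (f i) 0) => [->|]; last by left.
  by rewrite add0r; right.
by rewrite finite_setU; split; exact: coprod_finite.
Qed.

Fact coprod_scale_finite a (f : coprod) : finite_set [set i | a *: f i != 0].
Proof.
apply: sub_finite_set (coprod_finite f) => i /=.
by apply: contra_neq => ->; rewrite scaler0.
Qed.

Fact coprod_opp_finite (f : coprod) : finite_set [set i | - f i != 0].
Proof.
by apply: sub_finite_set (coprod_finite f) => i /=; rewrite oppr_eq0.
Qed.

Definition coprod_zero := Coprod coprod_zero_finite.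
Definition coprod_opp f := Coprod (coprod_opp_finite f).
Definition coprod_add f g := Coprod (coprod_add_finite f g).
Definition coprod_scale a f := Coprod (coprod_scale_finite a f).

Fact coprod_addA : associative coprod_add.
Proof. by move=> f g h; apply: coprodP => i /=; rewrite addrA. Qed.

Fact coprod_addC : commutative coprod_add.
Proof. by move=> f g; apply: coprodP => i /=; rewrite addrC. Qed.

Fact coprod_add0 : left_id coprod_zero coprod_add.
Proof. by move=> f; apply: coprodP => i /=; rewrite add0r. Qed.

Fact coprod_addN : left_inverse coprod_zero coprod_opp coprod_add.
Proof. by move=> f; apply: coprodP => i /=; rewrite addNr. Qed.

HB.instance Definition _ := GRing.isZmodule.Build coprod
  coprod_addA coprod_addC coprod_add0 coprod_addN.

Fact coprod_scaleA a b f :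
  coprod_scale a (coprod_scale b f) = coprod_scale (a * b) f.
Proof. by apply: coprodP => i /=; rewrite scalerA. Qed.

Fact coprod_scale1 : left_id 1 coprod_scale.
Proof. by move=> f; apply: coprodP => i /=; rewrite scale1r. Qed.

Fact coprod_scaleDr : right_distributive coprod_scale +%R.
Proof. by move=> a f g; apply: coprodP => i /=; rewrite scalerDr. Qed.

Fact coprod_scaleDl f : {morph coprod_scale^~ f : a b / a + b}.
Proof. by move=> a b; apply: coprodP => i /=; rewrite scalerDl. Qed.

HB.instance Definition _ := GRing.Zmodule_isLmodule.Build K coprod
  coprod_scaleA coprod_scale1 coprod_scaleDr coprod_scaleDl.

Fact coprod_in_finite i (x : W i) :
  finite_set [set j | dfwith (fun j => 0 : W j) x j != 0].
Proof.
apply: sub_finite_set (finite_set1 i) => j /=.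
by apply: contra_neqP => /eqP ij; rewrite dfwith_out // eq_sym.
Qed.

Definition coprod_in i (x : W i) : coprod := Coprod (coprod_in_finite x).

End Coproduct.

Section AssociatedGraded.
Variables (K : numFieldType) (V : lmodType K).
Variables (Y : vertex_algebra V) (E : int -> submodClosed V).

Definition gr_piece (n : int) : lmodType K := quotspace (E n) (E (n - 1)).

Definition gr : lmodType K := coprod gr_piece.

Definition gr_comp (n : int) : set gr :=
  range (fun x : gr_piece n => coprod_in x : gr).

(* u + E_(n-1), for u in E_n.  Outside E_n the value is 0, which is never used
   under the axioms of a good filtration. *)
Definition gr_class (n : int) (u : V) : gr :=
  coprod_in (\pi_(gr_piece n) (insubd (0 : subsp (E n)) u) : gr_piece n).

(* A representative in E_n, chosen by [repr], of the component of degree n. *)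
Definition gr_repr (f : gr) (n : int) : V :=
  val (repr (f n) : subsp (E n)).

Definition gr_mul (f g : gr) : gr :=
  \sum_(m \in [set: int]) \sum_(n \in [set: int])
     gr_class (m + n) (Y (gr_repr f m) (-1) (gr_repr g n)).

Definition gr_one : gr := gr_class 0 (va_one Y).

Definition gr_der (f : gr) : gr :=
  \sum_(m \in [set: int]) gr_class m (va_D Y (gr_repr f m)).

Definition gr_prod (f : gr) (i : nat) (g : gr) : gr :=
  \sum_(m \in [set: int]) \sum_(n \in [set: int])
     gr_class (m + n - 1) (Y (gr_repr f m) i%:Z (gr_repr g n)).

End AssociatedGraded.

Arguments gr_comp {K V} E n.
Arguments gr_class {K V} E n u.
Arguments gr_mul {K V} Y E f g.
Arguments gr_one {K V} Y E.
Arguments gr_der {K V} Y E f.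
Arguments gr_prod {K V} Y E f i g.

(* Main.v *)
Require Import Defs.
From HB Require Import structures.
From mathcomp Require Import all_boot all_order all_algebra.
From mathcomp Require Import complex.
From mathcomp Require Import boolp classical_sets functions cardinality fsbigop.
From mathcomp Require Import reals.
From mathcomp Require Import finmap ring zify.

(* Everything follows from the component form (Borcherds identity) of the
   Jacobi identity.  The commutator formula, skew symmetry, (Du)_n = - n u_(n-1)
   and the derivation property of D are homogeneous identities of V, and give
   C1-C3 and the derivation property of the product.  Commutativity,
   associativity and the Leibniz rule of u_n hold in V up to terms with one more
   mode u_k, k >= 0, than the leading ones; each such mode lowers the filtration
   degree by one, so these terms vanish in the graded space. *)

Set Implicit Arguments.
Unset Strict Implicit.
Unset Printing Implicit Defensive.

Import Order.TTheory GRing.Theory Num.Theory.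

Local Open Scope quotient_scope.
Local Open Scope classical_set_scope.
Local Open Scope ring_scope.

(** * Binomial coefficients with an integer upper argument *)

Section BinomZ.
Variable K : numFieldType.

Lemma binomZ_0r (n : int) : binomZ K n 0 = 1.
Proof. by rewrite /binomZ big_ord0 fact0 divr1. Qed.

Lemma binomZ_1r (n : int) : binomZ K n 1 = n%:~R.
Proof. by rewrite /binomZ big_ord1 (_ : 1`! = 1)%N // divr1 subr0. Qed.

Lemma binomZ_nat (n k : nat) : binomZ K n k = 'C(n, k)%:R.
Proof.
rewrite /binomZ.
have -> : \prod_(j < k) ((Posz n)%:~R - j%:R) = (n ^_ k)%:R :> K.
  elim: k => [|k IHk]; first by rewrite big_ord0 ffactn0.
  rewrite big_ord_recr IHk ffactnSr natrM /=.
  case: (leqP k n) => [kn|nk]; first by rewrite natrB.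
  by rewrite ffact_small // !mul0r.
by rewrite -bin_ffact natrM mulfK // pnatr_eq0 -lt0n fact_gt0.
Qed.

(** Once the product on the right is reversed, its factor of index j is n + j, the negative of - n -
    j; the k signs make up the power of -1. *)
Lemma binomZN (n : int) k :
  binomZ K (- n) k = (-1) ^+ k * binomZ K (n + k%:Z - 1) k.
Proof.
rewrite /binomZ mulrA; congr (_ / _).
rewrite [X in _ = _ * X](reindex_inj rev_ord_inj) /=.
rewrite -[X in (-1) ^+ X](card_ord k) -prodr_const -big_split /=.
apply: eq_bigr => j _; rewrite natrB // -addn1 natrD.
by rewrite !(rmorphN, rmorphB, rmorphD) /=; ring.
Qed.

Lemma binomZ_N1 k : binomZ K (-1) k = (-1) ^+ k.
Proof. by rewrite binomZN addrAC subrr add0r binomZ_nat binn mulr1. Qed.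

Lemma binomZ_N2 k : binomZ K (-2) k = (-1) ^+ k * k.+1%:R.
Proof.
rewrite binomZN (_ : 2 + k%:Z - 1 = k.+1); last by lia.
by rewrite binomZ_nat binSn.
Qed.

Lemma binomZ_0l k : binomZ K 0 k = (k == 0)%N%:R.
Proof. by rewrite (binomZ_nat 0); case: k. Qed.

End BinomZ.

(** * Finitely supported sums *)

Lemma fsbig_trunc (V : nmodType) (F : nat -> V) N :
  (forall k, (N <= k)%N -> F k = 0) ->
  \sum_(k \in [set: nat]) F k = \sum_(k < N) F k.
Proof.
move=> F0; rewrite fsbig_ord; apply/esym/fsbig_widen => //.
by move=> k [_ /negP]; rewrite -leqNgt => /F0.
Qed.

Lemma fsbig_only (V : nmodType) (I : choiceType) (F : I -> V) i :
  (forall k, k != i -> F k = 0) -> \sum_(k \in [set: I]) F k = F i.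
Proof.
move=> F0; rewrite -[RHS](@fsbig_set1 _ 0 +%R _ i F); apply/esym.
apply: fsbig_widen => // k [_ /= /eqP]; exact: F0.
Qed.

(** A sum with infinite support is 0 by convention, hence also in [S]; otherwise it is a finite sum
    of elements of [S]. *)
Lemma rpred_fsbig (I : choiceType) (K : numFieldType) (V : lmodType K)
    (S : submodClosed V) (D : set I) (F : I -> V) :
  (forall i, F i \in S) -> \sum_(i \in D) F i \in S.
Proof. by move=> FS; apply: rpred_sum. Qed.

(** Since infinite support would make a sum collapse to 0, additivity rests on finite supports: over
    the union of the supports at u and v, all three sums are ordinary finite sums. *)
Lemma fsbig_linear (K : numFieldType) (I : choiceType) (U W : lmodType K)
    (h : I -> U -> W) :
  (forall i, linear (h i)) ->
  (forall u, finite_set [set i | h i u != 0]) ->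
  linear (fun u => \sum_(i \in [set: I]) h i u).
Proof.
move=> hl hf a u v.
set D := [set i | h i u != 0] `|` [set i | h i v != 0].
have Df : finite_set D by rewrite finite_setU.
have hD w : (forall i, h i u = 0 -> h i v = 0 -> h i w = 0) ->
    \sum_(i \in [set: I]) h i w = \sum_(i \in D) h i w.
  move=> hw; apply/esym/fsbig_widen => // i [_ /not_orP[]] /=.
  by move=> /negP/negPn/eqP hu /negP/negPn/eqP hv; exact: hw.
rewrite !hD //; last by move=> i hu hv; rewrite hl hu hv scaler0 add0r.
rewrite !fsbig_finite // scaler_sumr -big_split /=.
by apply: eq_bigr => i _; rewrite hl.
Qed.

(** * Closure properties of linear maps *)

Section LinearMaps.
Variables (K : numFieldType) (U V W : lmodType K).

Lemma lin0 (f : U -> V) : linear f -> f 0 = 0.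
Proof.
by move=> fl; have := fl (-1) 0 0; rewrite scaler0 addr0 scaleN1r addNr.
Qed.

Lemma linD (f : U -> V) : linear f -> {morph f : u v / u + v}.
Proof. by move=> fl u v; have := fl 1 u v; rewrite !scale1r. Qed.

Lemma linZ (f : U -> V) a : linear f -> {morph f : u / a *: u}.
Proof. by move=> fl u; have := fl a u 0; rewrite !addr0 (lin0 fl) addr0. Qed.

Lemma linB (f : U -> V) : linear f -> {morph f : u v / u - v}.
Proof. by move=> fl u v; rewrite -!scaleN1r (linD fl) (linZ _ fl). Qed.

Lemma linear_comp_fun (g : V -> W) (f : U -> V) :
  linear g -> linear f -> linear (fun u => g (f u)).
Proof. by move=> gl fl a u v; rewrite fl gl. Qed.

Lemma linear_add_fun (f g : U -> V) :
  linear f -> linear g -> linear (fun u => f u + g u).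
Proof. by move=> fl gl a u v; rewrite fl gl scalerDr addrACA. Qed.

Lemma linear_opp_fun (f : U -> V) : linear f -> linear (fun u => - f u).
Proof. by move=> fl a u v; rewrite fl opprD scalerN. Qed.

Lemma linear_scale_fun c (f : U -> V) :
  linear f -> linear (fun u => c *: f u).
Proof. by move=> fl a u v; rewrite fl scalerDr !scalerA mulrC. Qed.

Lemma linear_muln_fun n (f : U -> V) :
  linear f -> linear (fun u => f u *+ n).
Proof. by move=> fl a u v; rewrite fl mulrnDl scalerMnr. Qed.

Lemma linear_sum_fun N (h : 'I_N -> U -> V) :
  (forall i, linear (h i)) -> linear (fun u => \sum_(i < N) h i u).
Proof.
move=> hl a u v; rewrite scaler_sumr -big_split /=.
by apply: eq_bigr => i _; exact: hl.
Qed.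

Lemma linear_iter n (d : U -> U) : linear d -> linear (iter n d).
Proof. by move=> dl; elim: n => [|n IHn] a u v //=; rewrite IHn dl. Qed.

End LinearMaps.

(** * From the Jacobi identity to the Borcherds identity *)

Section VertexAlgebra.
Variables (K : numFieldType) (V : lmodType K) (Y : vertex_algebra V).
Implicit Types (u v w : V) (l m n : int) (k : nat).

Local Notation one := (va_one Y).
Local Notation D := (va_D Y).

(** Each product in the Jacobi identity has its nonzero terms on a one-parameter family of exponents
    [h k]; reindexing along [h] collapses the sum over triples to a sum over k. *)
Lemma mul_series3E (f : series3 K) (g : series3 V) (e : int * int * int)
    (h : nat -> int * int * int) :
  injective h ->
  (forall a, f a *: g (e - a) != 0 -> exists k, h k = a) ->
  mul_series3 f g e = \sum_(k \in [set: nat]) f (h k) *: g (e - h k).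
Proof.
move=> hinj hsupp; rewrite /mul_series3.
rewrite -(@fsbig_image _ _ _ _ _ setT h (fun a => f a *: g (e - a)));
  last by move=> x y _ _; exact: hinj.
apply/esym/fsbig_widen => // a [_ na] /=.
by apply: contra_notP na => /eqP/hsupp[k <-]; exists k.
Qed.

(* The coefficient of x0^(-l-1) x1^(-m-1) x2^(-n-1) in the Jacobi identity. *)
Lemma va_Borcherds u v w l m n :
  \sum_(k \in [set: nat])
     ((-1) ^+ k * binomZ K l k) *: Y u (m + l - k%:Z) (Y v (n + k%:Z) w)
  - \sum_(k \in [set: nat])
     ((-1) ^ l * ((-1) ^+ k * binomZ K l k)) *:
        Y v (n + l - k%:Z) (Y u (m + k%:Z) w)
  = \sum_(k \in [set: nat])
     binomZ K m k *: Y (Y u (l + k%:Z) v) (m + n - k%:Z) w.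
Proof.
have := va_Jacobi Y u v w (- l - 1, - m - 1, - n - 1).
(* The operator product does not involve x0, so the delta factor carries the whole exponent - l - 1
   of x0; its binomial (x1 - x2)^l then contributes x1^(l-k) x2^k. The two other families arise in
   the same way. *)
rewrite (@mul_series3E _ _ _ (fun k => (- l - 1, l - k%:Z, k%:Z))); first last.
- move=> [[r p] q] /=; rewrite /powB_coef.
  case: (eqVneq (- l - 1 - r) 0) => [hr|_]; last by rewrite scaler0 eqxx.
  case: q => [k|k]; last by rewrite scale0r eqxx.
  case: (p =P - r - 1 - k%:Z) => [hp|_]; last by rewrite scale0r eqxx.
  by exists k; congr (_, _, _); lia.
- by move=> k k' [].
rewrite (@mul_series3E _ _ _ (fun k => (- l - 1, k%:Z, l - k%:Z))); first last.
- move=> [[r p] q] /=; rewrite /powB_coef.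
  case: (eqVneq (- l - 1 - r) 0) => [hr|_]; last by rewrite scaler0 eqxx.
  case: p => [k|k]; last by rewrite mulr0 scale0r eqxx.
  case: (q =P - r - 1 - k%:Z) => [hp|_]; last by rewrite mulr0 scale0r eqxx.
  by exists k; congr (_, _, _); lia.
- by move=> k k' [].
rewrite (@mul_series3E _ _ _ (fun k => (k%:Z, - m - 1, m - k%:Z))); first last.
- move=> [[r p] q] /=; rewrite /powB_coef.
  case: (eqVneq (- m - 1 - p) 0) => [hr|_]; last by rewrite scaler0 eqxx.
  case: r => [k|k]; last by rewrite scale0r eqxx.
  case: (p =P - q - 1 - k%:Z) => [hp|_]; last by rewrite scale0r eqxx.
  by exists k; congr (_, _, _); lia.
- by move=> k k' [].
set A := (X in X - _ = _ -> _); set B := (X in _ - X = _ -> _).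
set C := (X in _ = X -> _).
have -> : A = \sum_(k \in [set: nat])
     ((-1) ^+ k * binomZ K l k) *: Y u (m + l - k%:Z) (Y v (n + k%:Z) w).
  apply: eq_fsbigr => k _ /=; rewrite subrr eqxx /powB_coef.
  rewrite (_ : - (- l - 1) - 1 = l) ?eqxx; last by lia.
  by congr (_ *: Y u _ (Y v _ w)); lia.
have -> : B = \sum_(k \in [set: nat])
     ((-1) ^ l * ((-1) ^+ k * binomZ K l k)) *:
        Y v (n + l - k%:Z) (Y u (m + k%:Z) w).
  apply: eq_fsbigr => k _ /=; rewrite subrr eqxx /powB_coef.
  rewrite (_ : - (- l - 1) - 1 = l) ?eqxx; last by lia.
  by congr (_ *: Y v _ (Y u _ w)); lia.
have -> // : C = \sum_(k \in [set: nat])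
     binomZ K m k *: Y (Y u (l + k%:Z) v) (m + n - k%:Z) w.
apply: eq_fsbigr => k _ /=; rewrite subrr eqxx /powB_coef.
rewrite (_ : - m - 1 == _) ?eqxx; last by lia.
(* The delta function gives (-1)^k times the binomial of -(m - k + 1) over k; upper negation turns
   this into the binomial of m over k. *)
rewrite (_ : - (m - k%:Z) - 1 = - (m - k%:Z + 1)); last by lia.
rewrite binomZN (_ : m - k%:Z + 1 + k%:Z - 1 = m); last by lia.
rewrite mulrA -exprMn mulrNN mulr1 expr1n mul1r.
by congr (_ *: Y (Y u _ v) _ w); lia.
Qed.

(** * Consequences of the Borcherds identity in the vertex algebra *)

Lemma va_mode0l n v : Y 0 n v = 0.
Proof. exact: lin0 (va_linearl Y n v). Qed.

Lemma va_mode0r u n : Y u n 0 = 0.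
Proof. exact: lin0 (va_linearr Y u n). Qed.

Lemma va_vacuum1 n v : n = -1 -> Y one n v = v.
Proof. by move=> ->; rewrite va_vacuum eqxx. Qed.

Lemma va_vacuum0 n v : n != -1 -> Y one n v = 0.
Proof. by rewrite va_vacuum => /negbTE->. Qed.

Lemma va_trunc_nat u v :
  exists N, forall k, (N <= k)%N -> Y u k%:Z v = 0.
Proof.
have [M uv0] := va_trunc Y u v; exists `|M|%N => k Mk.
by apply: uv0; lia.
Qed.

(** The case l = 0 of [va_Borcherds]: the binomials of 0 leave only k = 0 in both sums on the
    left. *)
Lemma va_commutator u v w m n :
  Y u m (Y v n w) - Y v n (Y u m w) =
  \sum_(k \in [set: nat]) binomZ K m k *: Y (Y u k%:Z v) (m + n - k%:Z) w.
Proof.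
have := va_Borcherds u v w 0 m n.
under [X in _ = X -> _]eq_fsbigr => k _ do rewrite add0r.
move=> <-; rewrite (@fsbig_only _ _ _ 0%N); last first.
  by move=> k k0; rewrite binomZ_0l (negbTE k0) mulr0 scale0r.
rewrite (@fsbig_only _ _ _ 0%N); last first.
  by move=> k k0; rewrite binomZ_0l (negbTE k0) !mulr0 scale0r.
by rewrite !binomZ_0r expr0 expr0z !mulr1 !scale1r !addr0 ?subr0.
Qed.

Lemma va_commutator_nat u v w (m : nat) n :
  Y u m%:Z (Y v n w) - Y v n (Y u m%:Z w) =
  \sum_(k < m.+1) Y (Y u k%:Z v) (m%:Z + n - k%:Z) w *+ 'C(m, k).
Proof.
rewrite va_commutator (@fsbig_trunc _ _ m.+1); last first.
  by move=> k mk; rewrite binomZ_nat bin_small // scale0r.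
by apply: eq_bigr => k _; rewrite binomZ_nat scaler_nat.
Qed.

(** The case m = 0 of [va_Borcherds]: only k = 0 survives on the right. *)
Lemma va_iterate u v w l n :
  Y (Y u l v) n w =
  \sum_(k \in [set: nat])
     ((-1) ^+ k * binomZ K l k) *: Y u (l - k%:Z) (Y v (n + k%:Z) w)
  - \sum_(k \in [set: nat])
     ((-1) ^ l * ((-1) ^+ k * binomZ K l k)) *:
        Y v (n + l - k%:Z) (Y u k%:Z w).
Proof.
have := va_Borcherds u v w l 0 n.
rewrite [X in _ = X -> _](@fsbig_only _ _ _ 0%N); last first.
  by move=> k k0; rewrite binomZ_0l (negbTE k0) scale0r.
rewrite binomZ_0r scale1r !addr0 !add0r => <-.
by congr (_ - _); apply: eq_fsbigr => k _; rewrite !add0r.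
Qed.

(** Apply [va_iterate] to u_(-2) 1. The vacuum acts only through its mode -1, so at most one term
    survives: one of the first sum if n < 0, one of the second if n > 0, none if n = 0. *)
Lemma va_mode_D u n w : Y (D u) n w = - n%:~R *: Y u (n - 1) w.
Proof.
rewrite /va_D va_iterate.
have sgn k : (-1) ^+ k * binomZ K (-2) k = k.+1%:R.
  by rewrite binomZ_N2 mulrA -exprMn mulrNN mulr1 expr1n mul1r.
have -> : (-1 : K) ^ (-2) = 1 by rewrite -exprnN sqrrN expr1n invr1.
case: n => [[|j]|j].
- rewrite !fsbig1 ?subr0 ?oppr0 ?scale0r // => k _.
    by rewrite va_vacuum0 ?scaler0 //; lia.
  by rewrite va_vacuum0 ?va_mode0r ?scaler0 //; lia.
- rewrite fsbig1; last first.
    by move=> k _; rewrite va_vacuum0 ?va_mode0r ?scaler0 //; lia.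
  rewrite (@fsbig_only _ _ _ j); last first.
    by move=> k kj; rewrite va_vacuum0 ?scaler0 //; lia.
  rewrite va_vacuum1; last by lia.
  by rewrite sgn mul1r sub0r scaleNr; congr (- (_ *: Y u _ w)); lia.
- rewrite (@fsbig_only _ _ _ j); last first.
    by move=> k kj; rewrite va_vacuum0 ?va_mode0r ?scaler0 //; lia.
  rewrite va_vacuum1; last by lia.
  rewrite fsbig1 ?subr0; last first.
    by move=> k _; rewrite va_vacuum0 ?scaler0 //; lia.
  rewrite sgn NegzE rmorphN opprK /=.
  by congr (_ *: Y u _ w); lia.
Qed.

(** Apply [va_iterate] to (u_n v)_(-2) 1. Nonnegative modes kill the vacuum, which leaves k = 0,
    giving u_n (D v), and k = 1, giving - n u_(n-1) v = (D u)_n v. *)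
Lemma va_D_mode u n v : D (Y u n v) = Y (D u) n v + Y u n (D v).
Proof.
rewrite {1}/va_D va_iterate [X in _ - X]fsbig1 ?subr0; last first.
  by move=> k _; rewrite va_creation0 // va_mode0r scaler0.
rewrite (@fsbig_trunc _ _ 2); last first.
  by move=> k k2; rewrite va_creation0 ?va_mode0r ?scaler0 //; lia.
rewrite !big_ord_recl big_ord0 /= addr0 binomZ_0r binomZ_1r.
rewrite expr0 expr1 mulr1 scale1r subr0 addr0 addrC va_mode_D.
by rewrite mulN1r (_ : -2 + 1%:Z = -1) // va_creation.
Qed.

Lemma va_D_linear : linear D.
Proof. exact: va_linearl. Qed.

Lemma va_D_one : D one = 0.
Proof. by rewrite /va_D va_vacuum. Qed.

(** Identifies the divided powers of D with creation modes, the form in which they appear in skew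
    symmetry. *)
Lemma va_iter_D i v : iter i D v = i`!%:R *: Y v (-1 - i%:Z) one.
Proof.
elim: i => [|i IHi] /=; first by rewrite subr0 va_creation scale1r.
rewrite IHi (linZ _ va_D_linear) va_D_mode va_D_one va_mode0r addr0 va_mode_D.
rewrite scalerA factS natrM mulrC; congr (_ * _ *: Y v _ one); last by lia.
by rewrite -rmorphN /= -[RHS]/(i.+1%:Z%:~R); congr (_%:~R); lia.
Qed.

(** Apply [va_Borcherds] to v, u and the vacuum with exponents n, -1, 0. Creation kills the first
    sum and leaves u_n v, up to sign, in the second; on the right, the modes -1 - k acting on the
    vacuum are divided powers of D. *)
Lemma va_skew_symmetry u v (n : nat) :
  Y u n%:Z v = \sum_(i \in [set: nat])
    ((-1) ^+ (n + i + 1)%N / i`!%:R) *: iter i D (Y v (n + i)%N%:Z u).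
Proof.
have := va_Borcherds v u one n (-1) 0.
rewrite fsbig1; last first.
  by move=> k _; rewrite va_creation0 ?va_mode0r ?scaler0 //; lia.
rewrite (@fsbig_only _ _ _ 0%N); last first.
  by move=> k k0; rewrite va_creation0 ?va_mode0r ?scaler0 //; lia.
rewrite va_creation binomZ_0r !mulr1 sub0r add0r subr0 => H.
have -> : Y u n%:Z v = (-1) ^+ n.+1 *: - ((-1) ^ n%:Z *: Y u n%:Z v).
  by rewrite exprS mulN1r scalerN scaleNr opprK scalerA -exprMn mulrNN mulr1
     expr1n scale1r.
rewrite H.
have [N vu0] := va_trunc_nat v u.
rewrite (@fsbig_trunc _ _ N); last first.
  by move=> k Nk; rewrite -PoszD vu0 ?va_mode0l ?scaler0 //; lia.
rewrite [RHS](@fsbig_trunc _ _ N); last first.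
  move=> k Nk; rewrite vu0; last by lia.
  by rewrite (lin0 (linear_iter _ va_D_linear)) scaler0.
rewrite scaler_sumr; apply: eq_bigr => i _; rewrite va_iter_D !scalerA.
rewrite binomZ_N1 mulfVK ?pnatr_eq0 -?lt0n ?fact_gt0 // -exprD addSn addnS.
by rewrite !addn0 !addr0.
Qed.
End VertexAlgebra.

(** * Identities of the vertex algebra up to lower filtration degree *)

Section GoodFiltration.
Variables (K : numFieldType) (V : lmodType K) (Y : vertex_algebra V).
Variables (E : int -> submodClosed V) (goodE : is_good_filtration Y E).
Implicit Types (u v w : V) (m n p : int).

Lemma gf_negW m n p u v j : u \in E m -> v \in E n -> j < 0 ->
  m + n <= p -> Y u j v \in E p.
Proof.
by move=> um vn j0 /(gf_incr goodE); apply; exact: gf_neg.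
Qed.

Lemma gf_nnegW m n p u v j : u \in E m -> v \in E n -> 0 <= j ->
  m + n - 1 <= p -> Y u j v \in E p.
Proof.
by move=> um vn j0 /(gf_incr goodE); apply; exact: gf_nneg.
Qed.

Lemma va_D_filtration m u : u \in E m -> va_D Y u \in E m.
Proof.
by move=> um; apply: (gf_negW um (gf_one goodE)) => //; rewrite addr0.
Qed.

(** Evaluate the commutator of u_(-1) and v_(-1) on the vacuum: every term contains some u_k v with
    k >= 0, which costs one degree. *)
Lemma gf_mulC m n u v : u \in E m -> v \in E n ->
  Y u (-1) v - Y v (-1) u \in E (m + n - 1).
Proof.
move=> um vn; have := va_commutator Y u v (va_one Y) (-1) (-1).
rewrite !va_creation => ->; apply: rpred_fsbig => k; apply: rpredZ.
by apply: (gf_negW (gf_nneg goodE um vn _) (gf_one goodE)) => //; lia.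
Qed.

(** In [va_iterate] with l = n = -1, the term k = 0 of the first sum is u_(-1) v_(-1) w. All others
    contain v_k w or u_k w with k >= 0. *)
Lemma gf_mulA m n p u v w : u \in E m -> v \in E n -> w \in E p ->
  Y u (-1) (Y v (-1) w) - Y (Y u (-1) v) (-1) w \in E (m + n + p - 1).
Proof.
move=> um vn wp; rewrite va_iterate.
have [N vw0] := va_trunc_nat Y v w.
(* The mode of v in the term k is k - 1, hence the bound N + 1. *)
rewrite (@fsbig_trunc _ _ N.+1); last first.
  move=> [//|k] Nk; rewrite (_ : -1 + k.+1%:Z = k); last by lia.
  by rewrite vw0 // va_mode0r scaler0.
rewrite big_ord_recl /= binomZ_0r expr0 mulr1 scale1r.
rewrite (_ : -1 - 0%:Z = -1) //.
rewrite !opprD addrA addrA subrr sub0r opprK.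
apply: rpredD; last first.
  apply: rpred_fsbig => k; apply: rpredZ.
  by apply: (gf_negW vn (gf_nneg goodE um wp _)) => //; lia.
rewrite -scaleN1r; apply: rpredZ; apply: rpred_sum => k _; apply: rpredZ.
rewrite /bump leq0n add1n (_ : -1 + k.+1%:Z = k); last by lia.
by apply: (gf_negW um (gf_nneg goodE vn wp _)) => //; lia.
Qed.

(** The top term k = i of the commutator formula is (u_i v)_(-1) w. For k < i the term (u_k
    v)_(i-1-k) w has two nonnegative modes, so it drops two degrees, one more than the Leibniz rule
    itself. *)
Lemma gf_Leibniz m n p u v w (i : nat) : u \in E m -> v \in E n -> w \in E p ->
  Y u i%:Z (Y v (-1) w) - (Y (Y u i%:Z v) (-1) w + Y v (-1) (Y u i%:Z w))
    \in E (m + n + p - 1 - 1).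
Proof.
move=> um vn wp; rewrite opprD addrCA addrC va_commutator_nat.
rewrite big_ord_recr /= binn mulr1n.
rewrite (_ : i%:Z + -1 - i%:Z = -1) ?addrK; last by lia.
apply: rpred_sum => k _; apply: rpredMn.
by apply: (gf_nnegW (gf_nneg goodE um vn _) wp) => //; have := ltn_ord k; lia.
Qed.

End GoodFiltration.

(** * Direct sums and their homogeneous components *)

Section Coprod.
Variables (K : numFieldType) (I : choiceType) (W : I -> lmodType K).

Lemma coprod_in_id i (x : W i) : coprod_in x i = x.
Proof. exact: dfwith_in. Qed.

Lemma coprod_in_neq i j (x : W i) : i != j -> coprod_in x j = 0.
Proof. by move=> ij; rewrite /= dfwith_out. Qed.

Lemma coprod_in_linear i : linear (@coprod_in K I W i).
Proof.
move=> a x y; apply: coprodP => j.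
change (coprod_in (a *: x + y) j = a *: coprod_in x j + coprod_in y j).
have [<-|ij] := eqVneq i j; first by rewrite !coprod_in_id.
by rewrite !coprod_in_neq // scaler0 addr0.
Qed.

Lemma coprod_eq_sum (f : coprod W) :
  f = \sum_(i <- fset_set [set i | f i != 0]) coprod_in (f i).
Proof.
apply: coprodP => j.
have -> : forall s : seq I, (\sum_(i <- s) coprod_in (f i)) j =
    \sum_(i <- s) coprod_in (f i) j.
  by move=> s; apply: (big_morph (fun g : coprod W => g j)).
have [j0|j0] := eqVneq (f j) 0.
  rewrite big1 // => i _; have [ij|ij] := eqVneq i j.
    by rewrite ij coprod_in_id j0.
  by rewrite coprod_in_neq.
rewrite (bigD1_seq j) ?fset_uniq //=; last first.
  by rewrite in_fset_set; [exact: mem_set|exact: coprod_finite].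
rewrite -[X in X + _]/(coprod_in (f j) j) coprod_in_id big1 ?addr0 // => i ij.
by rewrite -[LHS]/(coprod_in (f i) j) coprod_in_neq.
Qed.

End Coprod.

(** * Classes and representatives in the associated graded space *)

Section Graded.
Variables (K : numFieldType) (V : lmodType K) (E : int -> submodClosed V).
Hypothesis E_incr : forall m n, m <= n -> {subset E m <= E n}.
Implicit Types (u v w : V) (m n p : int) (f g h : gr E).

Lemma gr_compP n f :
  gr_comp E n f <-> exists2 u, u \in E n & f = gr_class E n u.
Proof.
split=> [[x _ <-]|[u un ->]]; last first.
  by exists (\pi_(gr_piece E n) (insubd (0 : subsp (E n)) u)).
exists (val (repr x : subsp (E n))); first exact: valP.
by rewrite /gr_class valKd reprK.
Qed.

Lemma E_pred n : {subset E (n - 1) <= E n}.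
Proof. by apply: E_incr; lia. Qed.

(** The premise [m = n] allows degrees that are equal but written differently, as in commutativity
    and associativity. *)
Lemma gr_class_eq m n u v : m = n -> u \in E m -> v \in E m ->
  u - v \in E (m - 1) -> gr_class E m u = gr_class E n v.
Proof.
move=> <- um vm uv; congr coprod_in.
by apply/quotspace_eq; rewrite !insubdK.
Qed.

(** Membership in [E n] makes [insubd] return the vector itself instead of its default 0. *)
Lemma gr_class_linear a n u v : u \in E n -> v \in E n ->
  gr_class E n (a *: u + v) = a *: gr_class E n u + gr_class E n v.
Proof.
move=> un vn; rewrite /gr_class -coprod_in_linear; congr coprod_in.
rewrite -[a *: \pi_(gr_piece E n) _]/(quotspace_scale a _).
rewrite quotspace_scaleE -quotspace_addE.
have uvn : a *: u + v \in E n by rewrite rpredD // rpredZ.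
apply/quotspace_eq; set x := insubd _ u; set y := insubd _ v.
have -> : val (a *: x + y) = a *: val x + val y.
  by rewrite raddfD; congr (_ + _); exact: linearZ.
by rewrite !insubdK // subrr rpred0.
Qed.

Lemma gr_class_out n u : u \in E (n - 1) -> gr_class E n u = 0.
Proof.
(* Linearity applied to - u + u shows that the class of 0 is 0, to which u is then compared. *)
move=> un; have un' := E_pred un; have := gr_class_linear (-1) un' un'.
rewrite !scaleN1r !addNr => <-.
by apply: gr_class_eq; rewrite ?rpred0 ?subr0.
Qed.

Lemma gr_classZ a n u : u \in E n ->
  gr_class E n (a *: u) = a *: gr_class E n u.
Proof.
move=> un; have := gr_class_linear a un (rpred0 _).
by rewrite addr0 (gr_class_out (rpred0 _)) addr0.
Qed.

Lemma gr_classD n u v : u \in E n -> v \in E n ->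
  gr_class E n (u + v) = gr_class E n u + gr_class E n v.
Proof. by move=> un vn; have := gr_class_linear 1 un vn; rewrite !scale1r. Qed.

Lemma gr_classB n u v : u \in E n -> v \in E n ->
  gr_class E n (u - v) = gr_class E n u - gr_class E n v.
Proof.
move=> un vn; have := gr_class_linear (-1) vn un.
by rewrite !scaleN1r addrC => ->; rewrite addrC.
Qed.

Lemma gr_class_sum n N (F : 'I_N -> V) : (forall i, F i \in E n) ->
  gr_class E n (\sum_(i < N) F i) = \sum_(i < N) gr_class E n (F i).
Proof.
move=> FE; elim: N => [|N IHN] in F FE *.
  by rewrite !big_ord0 gr_class_out // rpred0.
by rewrite !big_ord_recr /= gr_classD ?rpred_sum // IHN.
Qed.

Lemma gr_repr_in f n : gr_repr f n \in E n.
Proof. exact: valP. Qed.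

Lemma gr_class_repr f n : gr_class E n (gr_repr f n) = coprod_in (f n).
Proof. by rewrite /gr_class /gr_repr valKd reprK. Qed.

(** Removes the dependence on the choice made by [repr]: a representative is known modulo the
    previous filtration step. *)
Lemma gr_repr_eq f u n : u \in E n ->
  f n = gr_class E n u n -> gr_repr f n - u \in E (n - 1).
Proof.
move=> un; rewrite /gr_class coprod_in_id => fn.
have /quotspace_eq : \pi_(gr_piece E n) (repr (f n) : subsp (E n)) =
    \pi_(gr_piece E n) (insubd (0 : subsp (E n)) u) by rewrite reprK.
by rewrite insubdK.
Qed.

Lemma gr_repr_out f n : f n = 0 -> gr_repr f n \in E (n - 1).
Proof.
move=> fn; rewrite -[gr_repr f n]subr0; apply: gr_repr_eq; first exact: rpred0.
by rewrite gr_class_out ?rpred0.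
Qed.

Lemma gr_repr_linear a f g n :
  gr_repr (a *: f + g) n - (a *: gr_repr f n + gr_repr g n) \in E (n - 1).
Proof.
have fn := gr_repr_in f n; have gn := gr_repr_in g n.
apply: gr_repr_eq; first by rewrite rpredD // rpredZ.
rewrite gr_class_linear // !gr_class_repr.
change (a *: f n + g n = a *: coprod_in (f n) n + coprod_in (g n) n).
by rewrite !coprod_in_id.
Qed.

Lemma gr_class_neq m n u : m != n -> gr_class E m u n = 0.
Proof. exact: coprod_in_neq. Qed.

Lemma gr_ind (P : gr E -> Prop) :
  P 0 -> (forall f g, P f -> P g -> P (f + g)) ->
  (forall n u, u \in E n -> P (gr_class E n u)) -> forall f, P f.
Proof.
move=> P0 PD Pc f; rewrite [f]coprod_eq_sum; apply: big_ind => // n _.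
by rewrite -gr_class_repr; apply: Pc; exact: gr_repr_in.
Qed.

(** Homogeneous classes span the graded space, by [gr_ind]; this reduces multilinear identities to
    computations with representatives. *)
Lemma gr_linear_ext (W : lmodType K) (phi psi : gr E -> W) :
  linear phi -> linear psi ->
  (forall n u, u \in E n -> phi (gr_class E n u) = psi (gr_class E n u)) ->
  forall f, phi f = psi f.
Proof.
move=> phil psil eqc; apply: gr_ind => [|f g fE gE|//].
  by rewrite (lin0 phil) (lin0 psil).
by rewrite (linD phil) (linD psil) fE gE.
Qed.

End Graded.

(** * Bilinear operations induced on the graded space *)

Section BilinearExtension.
Variables (K : numFieldType) (V : lmodType K) (E : int -> submodClosed V).
Hypothesis E_incr : forall m n, m <= n -> {subset E m <= E n}.
Variables (d : int -> int -> int) (F : V -> V -> V).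
Hypothesis dl : forall m n, d (m - 1) n = d m n - 1.
Hypothesis dr : forall m n, d m (n - 1) = d m n - 1.
Hypothesis Fl : forall v, linear (F^~ v).
Hypothesis Fr : forall u, linear (F u).
Hypothesis FE : forall m n u v, u \in E m -> v \in E n -> F u v \in E (d m n).
Implicit Types (u v w : V) (m n p : int) (f g h : gr E).

Local Notation term m n f g :=
  (gr_class E (d m n) (F (gr_repr f m) (gr_repr g n))).

(** The common form of [gr_mul] and [gr_prod], with [d m n] equal to m + n or m + n - 1 and [F] the
    mode -1 or i. *)
Definition gr_bilin f g : gr E :=
  \sum_(m \in [set: int]) \sum_(n \in [set: int]) term m n f g.

Let FEl m n u v : u \in E (m - 1) -> v \in E n -> F u v \in E (d m n - 1).
Proof. by rewrite -dl; exact: FE. Qed.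

Let FEr m n u v : u \in E m -> v \in E (n - 1) -> F u v \in E (d m n - 1).
Proof. by rewrite -dr; exact: FE. Qed.

(** Independence of representatives: the difference splits as F (u' - u) v' + F u (v' - v), and each
    summand has one argument a step lower in the filtration. *)
Let gr_class_F m n u u' v v' : u \in E m -> v \in E n ->
  u' - u \in E (m - 1) -> v' - v \in E (n - 1) ->
  gr_class E (d m n) (F u' v') = gr_class E (d m n) (F u v).
Proof.
move=> um vn uu vv.
have u'm : u' \in E m by rewrite -(subrK u u') rpredD // E_pred.
have v'n : v' \in E n by rewrite -(subrK v v') rpredD // E_pred.
apply: gr_class_eq; rewrite ?FE //.
have -> : F u' v' - F u v = F (u' - u) v' + F u (v' - v).
  by rewrite (linB (Fl v')) (linB (Fr u)) addrA subrK.
by apply: rpredD; [exact: FEl|exact: FEr].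
Qed.

Let term0l m n f g : f m = 0 -> term m n f g = 0.
Proof.
by move=> fm; rewrite gr_class_out // FEl ?gr_repr_in // gr_repr_out.
Qed.

Let term0r m n f g : g n = 0 -> term m n f g = 0.
Proof.
by move=> gn; rewrite gr_class_out // FEr ?gr_repr_in // gr_repr_out.
Qed.

Let term_linearl m n g : linear (fun f => term m n f g).
Proof.
move=> a f f'.
have fm := gr_repr_in f m; have f'm := gr_repr_in f' m.
have gn := gr_repr_in g n.
rewrite -gr_class_linear ?FE // -Fl; apply: gr_class_F => //.
- by rewrite rpredD // rpredZ.
- exact: gr_repr_linear.
- by rewrite subrr rpred0.
Qed.

Let term_linearr m n f : linear (fun g => term m n f g).
Proof.
move=> a g g'.
have fm := gr_repr_in f m; have gn := gr_repr_in g n.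
have g'n := gr_repr_in g' n.
rewrite -gr_class_linear ?FE // -Fr; apply: gr_class_F => //.
- by rewrite rpredD // rpredZ.
- by rewrite subrr rpred0.
- exact: gr_repr_linear.
Qed.

Let finiter m f g : finite_set [set n | term m n f g != 0].
Proof.
apply: sub_finite_set (coprod_finite g) => n /=.
by apply: contra_neq; exact: term0r.
Qed.

Let finitel f g :
  finite_set [set m | \sum_(n \in [set: int]) term m n f g != 0].
Proof.
apply: sub_finite_set (coprod_finite f) => m /=.
by apply: contra_neq => fm; apply: fsbig1 => n _; exact: term0l.
Qed.

(** Terms vanish outside the supports of f and g, so the sums are finite and linearity passes
    through them; on homogeneous classes a single pair of degrees contributes. *)
Lemma gr_bilinP : [/\ forall g, linear (gr_bilin^~ g),
    forall f, linear (gr_bilin f)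
  & forall m n u v, u \in E m -> v \in E n ->
      gr_bilin (gr_class E m u) (gr_class E n v) = gr_class E (d m n) (F u v)].
Proof.
split=> [g|f|m n u v um vn].
- apply: fsbig_linear => [m|f]; last exact: finitel.
  by apply: fsbig_linear => [n|f]; [exact: term_linearl|exact: finiter].
- apply: (@fsbig_linear _ _ _ _
      (fun m g => \sum_(n \in [set: int]) term m n f g)) => [m|g].
    by apply: fsbig_linear => [n|g]; [exact: term_linearr|exact: finiter].
  exact: finitel.
rewrite /gr_bilin (@fsbig_only _ _ _ m); last first.
  move=> p pm; apply: fsbig1 => q _; apply: term0l.
  by apply: gr_class_neq; rewrite eq_sym.
rewrite (@fsbig_only _ _ _ n); last first.
  by move=> q qn; apply: term0r; apply: gr_class_neq; rewrite eq_sym.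
by apply: gr_class_F => //; exact: gr_repr_eq.
Qed.

End BilinearExtension.

(** * The operations of the graded space on homogeneous classes *)

Section VertexPoissonGraded.
Variables (K : numFieldType) (V : lmodType K) (Y : vertex_algebra V).
Variables (E : int -> submodClosed V) (goodE : is_good_filtration Y E).
Implicit Types (u v w : V) (m n p : int) (a b c : gr E).

Local Notation cls := (gr_class E).
Let E_incr := gf_incr goodE.

Let gr_mulP : [/\ forall b, linear (fun a => gr_mul Y E a b),
    forall a, linear (gr_mul Y E a)
  & forall m n u v, u \in E m -> v \in E n ->
      gr_mul Y E (cls m u) (cls n v) = cls (m + n) (Y u (-1) v)].
Proof.
apply: (gr_bilinP E_incr (d := fun m n => m + n) (F := fun u v => Y u (-1) v)).
- by move=> m n; lia.
- by move=> m n; lia.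
- by move=> v; exact: va_linearl.
- by move=> u; exact: va_linearr.
- by move=> m n u v um vn; exact: gf_neg.
Qed.

Lemma gr_mul_linearl b : linear (fun a => gr_mul Y E a b).
Proof. by have [+ _ _] := gr_mulP; exact. Qed.

Lemma gr_mul_linearr a : linear (gr_mul Y E a).
Proof. by have [_ + _] := gr_mulP; exact. Qed.

Lemma gr_mul_class m n u v : u \in E m -> v \in E n ->
  gr_mul Y E (cls m u) (cls n v) = cls (m + n) (Y u (-1) v).
Proof. by have [_ _ +] := gr_mulP; exact. Qed.

Let gr_prodP i : [/\ forall b, linear (fun a => gr_prod Y E a i b),
    forall a, linear (gr_prod Y E a i)
  & forall m n u v, u \in E m -> v \in E n ->
      gr_prod Y E (cls m u) i (cls n v) = cls (m + n - 1) (Y u i%:Z v)].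
Proof.
apply: (gr_bilinP E_incr (d := fun m n => m + n - 1)
  (F := fun u v => Y u i%:Z v)).
- by move=> m n; lia.
- by move=> m n; lia.
- by move=> v; exact: va_linearl.
- by move=> u; exact: va_linearr.
- by move=> m n u v um vn; exact: gf_nneg.
Qed.

Lemma gr_prod_linearl i b : linear (fun a => gr_prod Y E a i b).
Proof. by have [+ _ _] := gr_prodP i; exact. Qed.

Lemma gr_prod_linearr a i : linear (gr_prod Y E a i).
Proof. by have [_ + _] := gr_prodP i; exact. Qed.

Lemma gr_prod_class m n u v i : u \in E m -> v \in E n ->
  gr_prod Y E (cls m u) i (cls n v) = cls (m + n - 1) (Y u i%:Z v).
Proof. by have [_ _ +] := gr_prodP i; exact. Qed.

Let cls_D m u u' : u \in E m -> u' - u \in E (m - 1) ->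
  cls m (va_D Y u') = cls m (va_D Y u).
Proof.
move=> um uu.
have u'm : u' \in E m by rewrite -(subrK u u') rpredD // E_pred.
apply: gr_class_eq; rewrite ?(va_D_filtration goodE) //.
by rewrite -(linB (va_D_linear Y)) va_D_filtration.
Qed.

Let cls_D0 m a : a m = 0 -> cls m (va_D Y (gr_repr a m)) = 0.
Proof.
by move=> am; rewrite gr_class_out // va_D_filtration // gr_repr_out.
Qed.

Lemma gr_der_linear : linear (gr_der Y E).
Proof.
apply: fsbig_linear => [m k a b|a].
  have am := gr_repr_in a m; have bm := gr_repr_in b m.
  rewrite -gr_class_linear ?(va_D_filtration goodE) //.
  rewrite -(va_D_linear Y); apply: cls_D; last exact: gr_repr_linear.
  by rewrite rpredD // rpredZ.
apply: sub_finite_set (coprod_finite a) => n /=.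
by apply: contra_neq; exact: cls_D0.
Qed.

Lemma gr_der_class m u : u \in E m -> gr_der Y E (cls m u) = cls m (va_D Y u).
Proof.
move=> um; rewrite /gr_der (@fsbig_only _ _ _ m); last first.
  by move=> p pm; apply: cls_D0; apply: gr_class_neq; rewrite eq_sym.
by apply: cls_D => //; exact: gr_repr_eq.
Qed.

Lemma gr_iter_der_class i m u : u \in E m ->
  iter i (va_D Y) u \in E m /\
  iter i (gr_der Y E) (cls m u) = cls m (iter i (va_D Y) u).
Proof.
move=> um; elim: i => [//|i [im IHi]] /=.
by rewrite IHi gr_der_class // va_D_filtration.
Qed.

(** Truncation in [V] gives a bound for each pair of homogeneous classes; sums in either argument
    take the maximum of two bounds. *)
Lemma gr_prod_trunc a b :
  exists N, forall n : nat, (N <= n)%N -> gr_prod Y E a n b = 0.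
Proof.
elim/gr_ind: a b => [|a a' IHa IHa'|m u um] b.
- by exists 0%N => n _; exact: lin0 (gr_prod_linearl n b).
- have [N Nn] := IHa b; have [N' Nn'] := IHa' b.
  exists (maxn N N') => n; rewrite geq_max => /andP[? ?].
  by rewrite (linD (gr_prod_linearl n b)) Nn // Nn' // addr0.
elim/gr_ind: b => [|b b' [N Nn] [N' Nn']|n v vn].
- by exists 0%N => n _; exact: lin0 (gr_prod_linearr _ n).
- exists (maxn N N') => n; rewrite geq_max => /andP[? ?].
  by rewrite (linD (gr_prod_linearr _ n)) Nn // Nn' // addr0.
have [N Nn] := va_trunc_nat Y u v; exists N => k /Nn uv0.
by rewrite gr_prod_class // uv0 gr_class_out // rpred0.
Qed.

(** Settles linearity conditions of [gr_linear_ext] by recursion on the shape of the expression. *)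
Ltac linear_tac := match goal with
  | |- GRing.linear_for _ (fun x => x) => by move=> ? ? ?
  | |- GRing.linear_for _ (gr_mul _ _ ?a) => exact: (gr_mul_linearr a)
  | |- GRing.linear_for _ (gr_prod _ _ ?a ?i) => exact: (gr_prod_linearr a i)
  | |- GRing.linear_for _ (fun x => @?f x + @?g x) =>
      apply: (@linear_add_fun _ _ _ f g); linear_tac
  | |- GRing.linear_for _ (fun x => - @?f x) =>
      apply: (@linear_opp_fun _ _ _ f); linear_tac
  | |- GRing.linear_for _ (fun x => @?f x *+ _) =>
      apply: (@linear_muln_fun _ _ _ _ f); linear_tac
  | |- GRing.linear_for _ (fun x => gr_der _ _ (@?f x)) =>
      apply: (@linear_comp_fun _ _ _ _ _ f gr_der_linear); linear_tac
  | |- GRing.linear_for _ (fun x => gr_mul _ _ ?a (@?f x)) =>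
      apply: (@linear_comp_fun _ _ _ _ _ f (gr_mul_linearr a)); linear_tac
  | |- GRing.linear_for _ (fun x => gr_mul _ _ (@?f x) _) =>
      apply: (@linear_comp_fun _ _ _ _ _ f (gr_mul_linearl _)); linear_tac
  | |- GRing.linear_for _ (fun x => gr_prod _ _ ?a ?i (@?f x)) =>
      apply: (@linear_comp_fun _ _ _ _ _ f (gr_prod_linearr a i)); linear_tac
  | |- GRing.linear_for _ (fun x => gr_prod _ _ (@?f x) _ _) =>
      apply: (@linear_comp_fun _ _ _ _ _ f (gr_prod_linearl _ _)); linear_tac
  | |- GRing.linear_for _ (fun x => \sum_(i < _) _) =>
      apply: linear_sum_fun => ?; linear_tac
  end.

(** * The identities of a vertex Poisson algebra *)

Lemma gr_mulC : commutative (gr_mul Y E).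
Proof.
(* Both sides are linear in each variable, so homogeneous classes suffice; the same reduction is
   used for the other identities below. *)
move=> a b; move: a; apply: gr_linear_ext => [||m u um]; [linear_tac..|].
move: b; apply: gr_linear_ext => [||n v vn]; [linear_tac..|].
rewrite !gr_mul_class //; apply: gr_class_eq; first exact: addrC.
- exact: gf_neg.
- by rewrite addrC; exact: gf_neg.
- exact: gf_mulC.
Qed.

Lemma gr_mulA : associative (gr_mul Y E).
Proof.
move=> a b c; move: a; apply: gr_linear_ext => [||m u um]; [linear_tac..|].
move: b; apply: gr_linear_ext => [||n v vn]; [linear_tac..|].
move: c; apply: gr_linear_ext => [||p w wp]; [linear_tac..|].
have vw : Y v (-1) w \in E (n + p) by exact: gf_neg.
have uv : Y u (-1) v \in E (m + n) by exact: gf_neg.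
rewrite !gr_mul_class //; apply: gr_class_eq; first exact: addrA.
- exact: gf_neg.
- by rewrite addrA; exact: gf_neg.
- by rewrite addrA; exact: gf_mulA.
Qed.

Lemma gr_mul1 : left_id (gr_one Y E) (gr_mul Y E).
Proof.
apply: gr_linear_ext => [||m u um]; [linear_tac..|].
by rewrite gr_mul_class ?(gf_one goodE) // va_vacuum1 // add0r.
Qed.

Lemma gr_der_mul a b : gr_der Y E (gr_mul Y E a b) =
  gr_mul Y E (gr_der Y E a) b + gr_mul Y E a (gr_der Y E b).
Proof.
move: a; apply: gr_linear_ext => [||m u um]; [linear_tac..|].
move: b; apply: gr_linear_ext => [||n v vn]; [linear_tac..|].
have um' := va_D_filtration goodE um; have vn' := va_D_filtration goodE vn.
rewrite gr_mul_class // !gr_der_class ?gf_neg // !gr_mul_class //.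
by rewrite -gr_classD ?gf_neg // va_D_mode.
Qed.

Lemma gr_prod_der a b (n : nat) :
  gr_prod Y E (gr_der Y E a) n b = - (gr_prod Y E a n.-1 b *+ n).
Proof.
move: a; apply: gr_linear_ext => [||m u um]; [linear_tac..|].
move: b; apply: gr_linear_ext => [||p v vp]; [linear_tac..|].
rewrite gr_der_class // !gr_prod_class ?(va_D_filtration goodE) //.
rewrite -scaler_nat -scaleNr -gr_classZ ?gf_nneg // va_mode_D.
(* For n = 0 the modes are -1 and 0 and do not match, but both coefficients are 0. *)
case: n => [|n]; first by rewrite !scaleNr !scale0r.
by rewrite (_ : n.+1%:Z - 1 = n) //; lia.
Qed.

Lemma gr_skew_symmetry a b (n : nat) : gr_prod Y E a n b =
  \sum_(i \in [set: nat]) ((-1) ^+ (n + i + 1)%N / i`!%:R) *: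
    iter i (gr_der Y E) (gr_prod Y E b (n + i)%N a).
Proof.
have iter_linear i := linear_iter i gr_der_linear.
(* Linearity of the sum over i requires finite support, which truncation of the products
   provides. *)
have fin x y : finite_set [set i | ((-1) ^+ (n + i + 1)%N / i`!%:R) *:
    iter i (gr_der Y E) (gr_prod Y E y (n + i)%N x) != 0].
  have [N yx0] := gr_prod_trunc y x.
  apply: sub_finite_set (finite_II N) => i /=.
  apply: contra_neqT; rewrite -leqNgt => Ni.
  by rewrite yx0 ?(lin0 (iter_linear i)) ?scaler0 //; lia.
move: a; apply: gr_linear_ext => [||m u um]; first by linear_tac.
  apply: fsbig_linear => [i|x]; last exact: fin.
  apply: linear_scale_fun; apply: (linear_comp_fun (iter_linear i)).
  exact: gr_prod_linearr.
move: b; apply: gr_linear_ext => [||p v vp]; first by linear_tac.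
  apply: (@fsbig_linear _ _ _ _ (fun i b => ((-1) ^+ (n + i + 1)%N / i`!%:R) *:
    iter i (gr_der Y E) (gr_prod Y E b (n + i)%N (cls m u)))) => [i|x].
    apply: linear_scale_fun; apply: (linear_comp_fun (iter_linear i)).
    exact: gr_prod_linearl.
  exact: fin.
rewrite gr_prod_class // va_skew_symmetry.
have [N vu0] := va_trunc_nat Y v u.
have vuE i : Y v (n + i)%N%:Z u \in E (m + p - 1).
  by rewrite (addrC m); exact: gf_nneg.
(* The one bound N for the modes of v on u truncates both the sum in [V] and the sum in the graded
   space. *)
rewrite !(@fsbig_trunc _ _ N); first last.
- move=> i Ni; rewrite vu0; last by lia.
  by rewrite (lin0 (linear_iter i (va_D_linear Y))) scaler0.
- move=> i Ni; rewrite gr_prod_class // vu0; last by lia.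
  by rewrite gr_class_out ?rpred0 // (lin0 (iter_linear i)) scaler0.
rewrite gr_class_sum // => [|i]; last first.
  by apply: rpredZ; have [] := gr_iter_der_class i (vuE i).
apply: eq_bigr => i _; have [iE iterE] := gr_iter_der_class i (vuE i).
by rewrite gr_classZ // gr_prod_class // (addrC p) iterE.
Qed.

Lemma gr_prod_commutator a b c (m n : nat) :
  gr_prod Y E a m (gr_prod Y E b n c) - gr_prod Y E b n (gr_prod Y E a m c) =
  \sum_(i < m.+1) gr_prod Y E (gr_prod Y E a i b) (m + n - i)%N c *+ 'C(m, i).
Proof.
move: a; apply: gr_linear_ext => [||p u up]; [linear_tac..|].
move: b; apply: gr_linear_ext => [||q v vq]; [linear_tac..|].
move: c; apply: gr_linear_ext => [||r w wr]; [linear_tac..|].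
(* Every term of the commutator formula applies two nonnegative modes, so the whole identity lives
   in degree p + q + r - 2. *)
have up' : Y u m%:Z (Y v n%:Z w) \in E (p + q + r - 1 - 1).
  by apply: gf_nnegW (gf_nneg goodE vq wr _) _ _ => //; lia.
have vq' : Y v n%:Z (Y u m%:Z w) \in E (p + q + r - 1 - 1).
  by apply: gf_nnegW (gf_nneg goodE up wr _) _ _ => //; lia.
have uvE i : Y (Y u i%:Z v) (m + n - i)%N%:Z w \in E (p + q + r - 1 - 1).
  by apply: gf_nnegW (gf_nneg goodE up vq _) wr _ _ => //; lia.
rewrite !gr_prod_class ?gf_nneg //.
under eq_bigr => i _.
  rewrite !gr_prod_class ?gf_nneg //.
  rewrite (_ : p + q - 1 + r - 1 = p + q + r - 1 - 1).
    by rewrite -scaler_nat -gr_classZ //; over.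
  by lia.
rewrite (_ : p + (q + r - 1) - 1 = p + q + r - 1 - 1); last by lia.
rewrite (_ : q + (p + r - 1) - 1 = p + q + r - 1 - 1); last by lia.
rewrite -gr_class_sum // => [|i]; last by rewrite rpredZ.
rewrite -gr_classB // va_commutator_nat; congr gr_class; apply: eq_bigr => i _.
(* The truncated subtraction m + n - i agrees with the integer one because i <= m. *)
rewrite scaler_nat -PoszD subzn //; have := ltn_ord i; lia.
Qed.

Lemma gr_prod_mul a (n : nat) b c : gr_prod Y E a n (gr_mul Y E b c) =
  gr_mul Y E (gr_prod Y E a n b) c + gr_mul Y E b (gr_prod Y E a n c).
Proof.
move: a; apply: gr_linear_ext => [||p u up]; [linear_tac..|].
move: b; apply: gr_linear_ext => [||q v vq]; [linear_tac..|].
move: c; apply: gr_linear_ext => [||r w wr]; [linear_tac..|].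
have uv : Y u n%:Z v \in E (p + q - 1) by exact: gf_nneg.
have uw : Y u n%:Z w \in E (p + r - 1) by exact: gf_nneg.
have vw : Y v (-1) w \in E (q + r) by exact: gf_neg.
have uvw : Y (Y u n%:Z v) (-1) w \in E (p + q + r - 1).
  by apply: (gf_negW goodE uv wr) => //; lia.
have vuw : Y v (-1) (Y u n%:Z w) \in E (p + q + r - 1).
  by apply: (gf_negW goodE vq uw) => //; lia.
rewrite !(gr_mul_class, gr_prod_class) //.
rewrite (_ : p + q - 1 + r = p + q + r - 1); last by lia.
rewrite (_ : q + (p + r - 1) = p + q + r - 1); last by lia.
rewrite -gr_classD // addrA; apply: gr_class_eq => //.
- by apply: (gf_nnegW goodE up vw) => //; lia.
- exact: rpredD.
- exact: gf_Leibniz.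
Qed.

Lemma gr_vertex_Poisson :
  is_vertex_Poisson_algebra
    (gr_mul Y E) (gr_one Y E) (gr_der Y E) (gr_prod Y E).
Proof.
split; [split|split|].
- exact: gr_mulC.
- exact: gr_mulA.
- exact: gr_mul1.
- exact: gr_mul_linearl.
- exact: gr_mul_linearr.
- exact: gr_der_linear.
- exact: gr_der_mul.
- exact: gr_der_linear.
- exact: gr_prod_linearl.
- exact: gr_prod_linearr.
- exact: gr_prod_trunc.
- exact: gr_prod_der.
- exact: gr_skew_symmetry.
- exact: gr_prod_commutator.
- exact: gr_prod_mul.
Qed.

End VertexPoissonGraded.

Theorem proposition4p2 (R : realType) (V : lmodType R[i])
    (Y : vertex_algebra V) (E : int -> submodClosed V)
    (goodE : is_good_filtration Y E) :
  [/\ [/\ forall m n u v, u \in E m -> v \in E n ->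
            gr_mul Y E (gr_class E m u) (gr_class E n v) =
            gr_class E (m + n) (Y u (-1) v),
          forall m u, u \in E m ->
            gr_der Y E (gr_class E m u) = gr_class E m (va_D Y u)
        & forall m n u v (i : nat), u \in E m -> v \in E n ->
            gr_prod Y E (gr_class E m u) i (gr_class E n v) =
            gr_class E (m + n - 1) (Y u i%:Z v)],
      is_vertex_Poisson_algebra
        (gr_mul Y E) (gr_one Y E) (gr_der Y E) (gr_prod Y E)
    & forall (m n : int) (a b : gr E) (i : nat),
        gr_comp E m a -> gr_comp E n b ->
        [/\ gr_comp E m (gr_der Y E a),
            gr_comp E (m + n) (gr_mul Y E a b)
          & gr_comp E (m + n - 1) (gr_prod Y E a i b)]].
Proof.
split; first split.
- by move=> m n u v; exact: gr_mul_class.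
- by move=> m u; exact: gr_der_class.
- by move=> m n u v i; exact: gr_prod_class.
- exact: gr_vertex_Poisson.
(* On representatives u and v the operations are given by D u, u_(-1) v and u_i v, so the grading
   statements become filtration bounds. *)
move=> m n a b i /gr_compP[u um ->] /gr_compP[v vn ->].
rewrite gr_der_class // gr_mul_class // gr_prod_class //.
split; apply/gr_compP; eexists; try reflexivity.
- exact: va_D_filtration.
- exact: gf_neg.
- exact: gf_nneg.
Qed.
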